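(* Let $X$ be a set with $|X|\geq 2$ and let $\mathcal{B} \subset \mathrm{Br}(X)$ be a length-compatible Hall set. 1. If $|X|\geq 3$, then for every $a<b \in \mathcal{B}$, $\|[a,b]\|_{\mathcal{B}} \leq 2^{|b|-1}$. 2. If $X \supset \{ X_0, X_1, X_2 \}$ with $X_0 < X_1 < X_2$, then for every $n\in \mathbb{N}$, $\mathrm{ad}_{X_1}^n (X_2) \in \mathcal{B}$ and $\| [X_0, \mathrm{ad}_{X_1}^n(X_2)] \|_{\mathcal{B}} = 2^n$ (so the estimate of item 1 is optimal). 3. If $|X|=2$, then for every $a<b \in \mathcal{B}$ with $|b|\geq 3$, $\|[a,b]\|_{\mathcal{B}} \leq 2^{|b|-3}$. 4. If $X=\{X_0,X_1\}$ with $X_0<X_1$, then for every $n \in \mathbb{N}$, $\mathrm{ad}_{X_1}^n\mathrm{ad}_{X_0}^2(X_1) \in \mathcal{B}$ and $\|[X_0,\mathrm{ad}_{X_1}^n\mathrm{ad}_{X_0}^2(X_1)]\|_{\mathcal{B}}=2^n$ (so the estimate of item 3 is optimal).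
   Context: The base field is $\mathbb{K}=\mathbb{R}$ or $\mathbb{C}$; $X$ is a set (possibly infinite) with at least two elements; $\mathbb{N}=\{0,1,\dots\}$. $\mathrm{Br}(X)$ is the free magma over $X$: the set of formal binary brackets (rooted planar binary trees with leaves labelled by elements of $X$), with product $(t_1,t_2)$. For $t\in \mathrm{Br}(X)$, $|t|$ is its number of leaves; if $t\notin X$, $t$ is written uniquely as $t=(\lambda(t),\mu(t))$. For $t_1,t_2\in\mathrm{Br}(X)$, $\mathrm{ad}_{t_1}(t_2):=(t_1,t_2)$. $\mathcal{L}(X)$ is the free Lie algebra over $X$ and $\mathrm{ev}:\mathrm{Br}(X)\to\mathcal{L}(X)$ is the canonical evaluation ($\mathrm{ev}(x)=x$ for $x\in X$, $\mathrm{ev}((t_1,t_2))=[\mathrm{ev}(t_1),\mathrm{ev}(t_2)]$). For $a,b\in\mathrm{Br}(X)$, $[a,b]$ denotes $[\mathrm{ev}(a),\mathrm{ev}(b)]\in\mathcal{L}(X)$. A Hall set is a subset $\mathcal{B}\subset\mathrm{Br}(X)$ endowed with a total order $<$ such that: (i) $X\subset\mathcal{B}$; (ii) for all $b_1,b_2\in\mathrm{Br}(X)$, $(b_1,b_2)\in\mathcal{B}$ iff $b_1,b_2\in\mathcal{B}$, $b_1<b_2$ and either $b_2\in X$ or $\lambda(b_2)\leq b_1$; (iii) for all $b_1,b_2\in\mathcal{B}$ with $(b_1,b_2)\in\mathcal{B}$, $b_1<(b_1,b_2)$. By a theorem of Viennot, $\mathrm{ev}$ is injective on $\mathcal{B}$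 and $\mathrm{ev}(\mathcal{B})$ is a basis of $\mathcal{L}(X)$. For $u=\sum_{c\in\mathcal{B}}\alpha_c\,\mathrm{ev}(c)\in\mathcal{L}(X)$ (finite sum), $\|u\|_{\mathcal{B}}:=\sum_{c}|\alpha_c|$. A Hall set $\mathcal{B}$ is length-compatible when for all $a,b\in\mathcal{B}$, $a<b$ implies $|a|\leq|b|$. *)

(* Defs.v *)
From HB Require Import structures.
From mathcomp Require Import all_boot all_order all_algebra.
From mathcomp Require Import finmap complex.
From mathcomp Require Import boolp classical_sets functions cardinality reals.

Set Implicit Arguments.
Unset Strict Implicit.
Unset Printing Implicit Defensive.

Import Order.TTheory GRing.Theory Num.Theory.

Local Open Scope classical_set_scope.
Local Open Scope ring_scope.

(* R[i] is the field of complex numbers over the reals R. *)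
Variant real_or_complex (R : realType) : numFieldType -> Prop :=
| IsReal : real_or_complex R R
| IsComplex : real_or_complex R R[i].

HB.mixin Record Lmodule_isLieAlgebra (K : fieldType) L of GRing.Lmodule K L := {
  lie : L -> L -> L;
  lie_linear_l : forall z : L, linear (fun x => lie x z);
  lie_linear_r : forall z : L, linear (lie z);
  lie_alternating : forall x : L, lie x x = 0;
  lie_jacobi : forall x y z : L,
    lie x (lie y z) + lie y (lie z x) + lie z (lie x y) = 0
}.

#[short(type="lieAlgType")]
HB.structure Definition LieAlgebra (K : fieldType) :=
  {L of GRing.Lmodule K L & Lmodule_isLieAlgebra K L}.

Definition lie_morphism (K : fieldType) (L M : lieAlgType K)
    (phi : {linear L -> M}) : Prop :=
  forall x y : L, phi (lie x y) = lie (phi x) (phi y).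

(* The universal property of the free Lie algebra over X, which determines
   (L, iota) up to a unique isomorphism. *)
Definition free_lie (K : fieldType) (X : Type) (L : lieAlgType K)
    (iota : X -> L) : Prop :=
  forall (M : lieAlgType K) (f : X -> M),
  exists phi : {linear L -> M},
    [/\ lie_morphism phi,
        forall x, phi (iota x) = f x
      & forall psi : {linear L -> M}, lie_morphism psi ->
          (forall x, psi (iota x) = f x) -> forall u, psi u = phi u].

Inductive br (X : Type) : Type :=
| Leaf : X -> br X
| Node : br X -> br X -> br X.

HB.instance Definition _ (X : Type) := gen_eqMixin (br X).
HB.instance Definition _ (X : Type) := gen_choiceMixin (br X).

Section Brackets.
Variable X : Type.
Implicit Types t : br X.

Definition is_leaf t : Prop := exists x : X, t = Leaf x.

(* The left factor; the value on leaves is irrelevant. *)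
Definition lambda t : br X := if t is Node t1 _ then t1 else t.

Fixpoint leaves t : nat :=
  if t is Node t1 t2 then (leaves t1 + leaves t2)%N else 1%N.

Definition ad t1 t2 : br X := Node t1 t2.

Fixpoint ev (K : fieldType) (L : lieAlgType K) (iota : X -> L) t : L :=
  match t with
  | Leaf x => iota x
  | Node t1 t2 => lie (ev iota t1) (ev iota t2)
  end.

(* B is ordered by the restriction of lt to B; the values of lt outside B play
   no role (if b2 is in B and is not a leaf then lambda b2 is also in B). *)
Record hall_set (B : set (br X)) (lt : br X -> br X -> Prop) : Prop := {
  hall_lt_irr : forall b, B b -> ~ lt b b;
  hall_lt_trans : forall a b c, B a -> B b -> B c -> lt a b -> lt b c -> lt a c;
  hall_lt_total : forall a b, B a -> B b -> [\/ lt a b, a = b | lt b a];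
  hall_leaf : forall x, B (Leaf x);
  hall_node : forall b1 b2, B (Node b1 b2) <->
    [/\ B b1, B b2, lt b1 b2
      & is_leaf b2 \/ (lt (lambda b2) b1 \/ lambda b2 = b1)];
  hall_lt_node : forall b1 b2,
    B b1 -> B b2 -> B (Node b1 b2) -> lt b1 (Node b1 b2)
}.

Definition length_compatible (B : set (br X)) (lt : br X -> br X -> Prop) :
    Prop :=
  forall a b, B a -> B b -> lt a b -> (leaves a <= leaves b)%N.

Section Norm.
Variables (K : numFieldType) (L : lieAlgType K) (iota : X -> L).
Variable B : set (br X).

Definition hall_coords (u : L) (alpha : {fsfun br X -> K with 0}) : Prop :=
  (forall c, c \in finsupp alpha -> B c) /\
  u = \sum_(c <- finsupp alpha) alpha c *: ev iota c.

(* When B is a Hall set and L is free, ev is injective on B with image a basis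
   of L, so that there is exactly one alpha satisfying hall_coords u alpha. *)
Definition hall_coord (u : L) : {fsfun br X -> K with 0} :=
  xget [fsfun] [set alpha | hall_coords u alpha].

Definition hall_norm (u : L) : K :=
  \sum_(c <- finsupp (hall_coord u)) `|hall_coord u c|.

End Norm.
End Brackets.

(* Main.v *)
(* Independence of the Hall basis. In the free associative algebra, send a word
   to the number of ways of rewriting it, as a sequence of letters, to the
   one-term sequence b, where two consecutive terms x, y with x < y, (x, y) in B
   and x at most all the terms before it become either (x, y) or y, x. This
   rewriting is terminating and confluent, and it mirrors xy = [x, y] + yx, so
   that the number attached to the polynomial of a Hall element c is 1 if c = b
   and 0 otherwise.

   Upper bounds. If a < b and (a, b) is not in B then b = (b1, b2) with a < b1,
   and [a, b] = [[a, b1], b2] + [b1, [a, b2]]. By length-compatibility, every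
   Hall element c occurring in [a, b1] satisfies lambda c <= b1, so that [c, b2]
   is a signed Hall element or 0. In [a, b2] one term remains a Hall element when
   bracketed with b1, and each of the others yields at most two. Without its
   distinguished term, [a, b] thus has at most N1 + 2 N2 terms, if [a, b1] has N1
   terms and [a, b2] has 1 + N2 terms. With two letters the bound improves
   because (x0, x1) is the only Hall element of length 2.

   Optimality. By the Leibniz rule for D = ad_{x1}, [x0, D^n z] is
   D^n (x0, z) plus the sum over j < n of binomial(n, j) times
   [D^(n-j-1) (x0, x1), D^j z], and these are, up to sign, distinct Hall
   elements. *)
Require Import Defs.
From HB Require Import structures.
From mathcomp Require Import all_boot all_order all_algebra.
From mathcomp Require Import finmap zify.
From mathcomp Require Import boolp classical_sets cardinality reals.
From mathcomp.multinomials Require Import monalg.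

Set Implicit Arguments.
Unset Strict Implicit.
Unset Printing Implicit Defensive.
Import Order.TTheory GRing.Theory Num.Theory.
Local Open Scope classical_set_scope.
Local Open Scope card_scope.
Local Open Scope ring_scope.

(** * Linear independence of the Hall basis *)

Lemma mulr_jacobi (R : pzRingType) (x y z : R) :
  x * (y * z - z * y) - (y * z - z * y) * x
    + (y * (z * x - x * z) - (z * x - x * z) * y)
    + (z * (x * y - y * x) - (x * y - y * x) * z) = 0.
Proof.
have swap (V : zmodType) (a b c d : V) : a - b - (c - d) = (a + d) - (b + c).
  by rewrite opprB opprD addrACA.
(* Up to the order of summands, the three double commutators now read A - B, B - C and C - A. *)
rewrite !mulrBr !mulrBl !mulrA !swap.
rewrite [y * z * x + _]addrC subrKA [z * x * y + _]addrC subrKA.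
by rewrite [z * y * x + _]addrC subrr.
Qed.

(** * The commutator Lie algebra of a monoid algebra *)

Section CommutatorLie.
Variables (K : fieldType) (M : monomType).

Definition commutator_lie := {malg K[M]}.
HB.instance Definition _ := GRing.Lmodule.on commutator_lie.

Definition commutator (x y : {malg K[M]}) : {malg K[M]} := x * y - y * x.

Lemma malg_scalerAr (c : K) (x y : {malg K[M]}) : x * (c *: y) = c *: (x * y).
Proof.
rewrite -(mul_malgC c y) mulrA scalerAl; congr (_ * _).
rewrite -mul_malgC !malgM_def fgmulUg fgmulgU.
by apply: eq_bigr => k _; rewrite mulrC mulm1 mul1m.
Qed.

Lemma commutator_linear_l z : linear (fun x => commutator x z).
Proof.
move=> c x y; rewrite /commutator mulrDl mulrDr -scalerAl malg_scalerAr.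
by rewrite scalerBr opprD addrACA.
Qed.

Lemma commutator_linear_r z : linear (commutator z).
Proof.
move=> c x y; rewrite /commutator mulrDl mulrDr -scalerAl malg_scalerAr.
by rewrite scalerBr opprD addrACA.
Qed.

Lemma commutator_jacobi x y z :
  commutator x (commutator y z) + commutator y (commutator z x)
    + commutator z (commutator x y) = 0.
Proof. exact: (mulr_jacobi (R := {malg K[M]})). Qed.

Fact commutator_alternating (x : {malg K[M]}) : commutator x x = 0.
Proof. exact: subrr. Qed.

HB.instance Definition _ := Lmodule_isLieAlgebra.Build K commutator_lie
  commutator_linear_l commutator_linear_r commutator_alternating
  commutator_jacobi.

End CommutatorLie.

Section HallBasis.
Variables (X : Type) (B : set (br X)) (lt : br X -> br X -> Prop).
Hypothesis hB : hall_set B lt.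
Local Notation le a b := (lt a b \/ a = b).

Lemma hall_nodeP x y : B (Node x y) ->
  [/\ B x, B y, lt x y & is_leaf y \/ le (lambda y) x].
Proof. by move/(hall_node hB). Qed.

Lemma le_lt_hall a b c : B a -> B b -> B c -> le a b -> lt b c -> lt a c.
Proof. by move=> Ba Bb Bc [ab|->] // bc; apply: (hall_lt_trans hB Ba Bb Bc). Qed.

Lemma lt_le_hall a b c : B a -> B b -> B c -> lt a b -> le b c -> lt a c.
Proof. by move=> Ba Bb Bc ab [bc|<-] //; apply: (hall_lt_trans hB Ba Bb Bc). Qed.

Lemma le_trans_hall a b c : B a -> B b -> B c -> le a b -> le b c -> le a c.
Proof. by move=> Ba Bb Bc ab [bc|<-] //; left; apply: (le_lt_hall Ba Bb Bc). Qed.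

(** * Termination and confluence of the rewriting *)

Section Rewriting.
Variable b : br X.

Definition legal_rise (p : seq (br X)) x y :=
  B (Node x y) /\ forall z, z \in p -> le x z.

(** A relation, because the legal rise to rewrite may be chosen freely; [rewrites_fun] shows that
    the count does not depend on the choices. *)
Inductive rewrites : seq (br X) -> nat -> Prop :=
| RewritesNormal s :
    (forall p x y q, s = p ++ x :: y :: q -> ~ legal_rise p x y) ->
    rewrites s (s == [:: b])
| RewritesStep p x y q m n :
    legal_rise p x y -> rewrites (p ++ Node x y :: q) m ->
    rewrites (p ++ y :: x :: q) n -> rewrites (p ++ x :: y :: q) (m + n).

(** Increasing pairs at any distance count, so that swapping an adjacent one lowers the total by
    exactly one. *)
Fixpoint rises (s : seq (br X)) : nat :=
  if s is x :: s' then (count (fun y => `[< lt x y >]) s' + rises s')%N else 0%N.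

Lemma rises_swap p x y q : B (Node x y) ->
  (rises (p ++ y :: x :: q) < rises (p ++ x :: y :: q))%N.
Proof.
move=> /hall_nodeP[Bx By xy _].
elim: p => [|z p IH] /=; last first.
  by rewrite !count_cat /=; lia.
have -> : `[< lt x y >] by apply/asboolP.
have -> : `[< lt y x >] = false.
  apply/asboolP => yx.
  by apply: (hall_lt_irr hB Bx (hall_lt_trans hB Bx By Bx xy yx)).
lia.
Qed.

Lemma rises_bound s : (rises s <= size s ^ 2)%N.
Proof.
elim: s => //= x s IH; have := count_size (fun y => `[< lt x y >]) s; nia.
Qed.

(** A join shortens the sequence but may create rises; the cube absorbs them, since n^3 + n^2 < (n +
    1)^3. *)
Definition rank s := (size s ^ 3 + rises s)%N.

Lemma rank_swap p x y q : B (Node x y) ->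
  (rank (p ++ y :: x :: q) < rank (p ++ x :: y :: q))%N.
Proof. by move=> /rises_swap-/(_ p q); rewrite /rank !size_cat /= ltn_add2l. Qed.

Lemma rank_join p x y q :
  (rank (p ++ Node x y :: q) < rank (p ++ x :: y :: q))%N.
Proof.
have := rises_bound (p ++ Node x y :: q).
rewrite /rank !size_cat /= !addnS; move: (_ + _)%N => n; nia.
Qed.

Lemma rewrites_total s : exists n, rewrites s n.
Proof.
have [k] := ubnP (rank s); elim: k s => // k IH s; rewrite ltnS => sk.
have [[p [x [y [q [e l]]]]]|ns] := pselect
    (exists p x y q, s = p ++ x :: y :: q /\ legal_rise p x y); last first.
  by eexists; apply: RewritesNormal => p x y q e l; apply: ns; exists p, x, y, q.
rewrite e in sk *.
have [m hm] := IH _ (leq_trans (rank_join p x y q) sk).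
have [n hn] := IH _ (leq_trans (rank_swap p q l.1) sk).
by exists (m + n)%N; apply: RewritesStep.
Qed.

(** A rise u, v further right satisfies u <= x, and x < (x, y) by the last Hall axiom, so u stays
    below the joined term. *)
Lemma legal_rise_join p x y q u v : B (Node x y) ->
  legal_rise (p ++ x :: y :: q) u v -> legal_rise (p ++ Node x y :: q) u v.
Proof.
move=> Bxy [Buv h]; split=> // z.
rewrite mem_cat inE => /or3P[zp|/eqP->|zq]; first by apply: h; rewrite mem_cat zp.
  have [Bx By _ _] := hall_nodeP Bxy; have [Bu _ _ _] := hall_nodeP Buv.
  have ux : le u x by apply: h; rewrite mem_cat mem_head orbT.
  by left; apply: (le_lt_hall Bu Bx Bxy ux); apply: (hall_lt_node hB).
by apply: h; rewrite mem_cat !inE zq !orbT.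
Qed.

Lemma legal_rise_swap p x y q u v :
  legal_rise (p ++ x :: y :: q) u v -> legal_rise (p ++ y :: x :: q) u v.
Proof.
by move=> [Buv h]; split=> // z zi; apply: h; move: zi; rewrite !mem_cat !inE
  [_ || (_ || (z \in q))]orbCA.
Qed.

Lemma rise_overlap (p q p' q' : seq (br X)) x y x' y' :
  p ++ x :: y :: q = p' ++ x' :: y' :: q' -> (size p <= size p')%N ->
  [\/ [/\ p = p', x = x', y = y' & q = q'], p' = rcons p x /\ x' = y
    | exists r, p' = p ++ x :: y :: r /\ q = r ++ x' :: y' :: q'].
Proof.
elim: p p' => [|z p IH] [|z' p'] //=.
- by case=> -> -> ->; constructor 1.
- case=> <-; case: p' => [|z'' p'] /= [<- e] _.
    by constructor 2.
  by constructor 3; exists p'.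
- case=> <- e; rewrite ltnS => /(IH _ e)[[-> -> -> ->]|[-> ->]|[r [-> ->]]].
  + by constructor 1.
  + by constructor 2.
  + by constructor 3; exists r.
Qed.

(** Actions on disjoint rises commute: both sides equal jj + js + sj + ss, where j stands for a
    join, s for a swap, and the left rise is named first. *)
Lemma rewrites_diamond p x y r x' y' q m1 m2 n1 n2 :
  let s := p ++ x :: y :: r ++ x' :: y' :: q in
  (forall t m n, (rank t < rank s)%N -> rewrites t m -> rewrites t n -> m = n) ->
  legal_rise p x y -> legal_rise (p ++ x :: y :: r) x' y' ->
  rewrites (p ++ Node x y :: r ++ x' :: y' :: q) m1 ->
  rewrites (p ++ y :: x :: r ++ x' :: y' :: q) m2 ->
  rewrites (p ++ x :: y :: r ++ Node x' y' :: q) n1 ->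
  rewrites (p ++ x :: y :: r ++ y' :: x' :: q) n2 -> (m1 + m2 = n1 + n2)%N.
Proof.
move=> s IH l l' rm1 rm2 rn1 rn2.
have [jj rjj] := rewrites_total (p ++ Node x y :: r ++ Node x' y' :: q).
have [js rjs] := rewrites_total (p ++ Node x y :: r ++ y' :: x' :: q).
have [sj rsj] := rewrites_total (p ++ y :: x :: r ++ Node x' y' :: q).
have [ss rss] := rewrites_total (p ++ y :: x :: r ++ y' :: x' :: q).
have em1 : m1 = (jj + js)%N.
  apply: (IH _ _ _ _ rm1); first exact: rank_join.
  rewrite -[_ ++ _]/(_ ++ (Node x y :: r) ++ _) catA.
  apply: RewritesStep; rewrite -?catA //.
  exact: legal_rise_join l.1 l'.
have em2 : m2 = (sj + ss)%N.
  apply: (IH _ _ _ _ rm2); first exact: rank_swap l.1.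
  rewrite -[_ ++ _]/(_ ++ (y :: x :: r) ++ _) catA.
  apply: RewritesStep; rewrite -?catA //.
  exact: legal_rise_swap l'.
have en1 : n1 = (jj + sj)%N.
  apply: (IH _ _ _ _ rn1); last exact: RewritesStep.
  rewrite /s -![_ ++ _ :: _ :: r ++ _]/(_ ++ (x :: y :: r) ++ _) !catA.
  exact: rank_join.
have en2 : n2 = (js + ss)%N.
  apply: (IH _ _ _ _ rn2); last exact: RewritesStep.
  rewrite /s -![_ ++ _ :: _ :: r ++ _]/(_ ++ (x :: y :: r) ++ _) !catA.
  exact: rank_swap l'.1.
lia.
Qed.

(* Distinct legal rises are disjoint, so the rewriting is confluent. *)
Lemma rewrites_fun s m n : rewrites s m -> rewrites s n -> m = n.
Proof.
have [k] := ubnP (rank s); elim: k s m n => // k IHk s m n; rewrite ltnS => sk.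
have {sk} IH t m' n' : (rank t < rank s)%N ->
    rewrites t m' -> rewrites t n' -> m' = n'.
  by move=> ts; apply: IHk; apply: leq_trans sk.
move=> rm; case: rm IH => [{}s ns|p x y q m1 m2 l r1 r2] IH rn.
  by case: rn ns {IH} => // p x y q ? ? l _ _ /(_ p x y q erefl).
move e : (p ++ x :: y :: q) rn => t rn.
case: rn e => [{}t ns|p' x' y' q' n1 n2 l' r1' r2'] e.
  by case: (ns _ _ _ _ (esym e) l).
(* Legality of the rise v, w after u would force v <= u, against u < v. *)
have overlap u v (p1 : seq (br X)) w : legal_rise p1 u v ->
    legal_rise (rcons p1 u) v w -> False.
  move=> [/hall_nodeP[Bu Bv uv _] _] [_ /(_ u)]; rewrite mem_rcons mem_head.
  by move=> /(_ isT) vu; apply: (hall_lt_irr hB Bu (lt_le_hall Bu Bv Bu uv vu)).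
case: (leqP (size p) (size p')) => [|/ltnW] le_pp'.
- case: (rise_overlap e le_pp').
  + move=> [ep ex ey eq]; move: r1' r2'; rewrite -ep -ex -ey -eq => r1' r2'.
    rewrite (IH _ _ _ (rank_join _ _ _ _) r1 r1').
    by rewrite (IH _ _ _ (rank_swap _ _ l.1) r2 r2').
  + by move=> [ep ex]; case: (overlap _ _ _ y' l); rewrite -ep -ex.
  + move=> [r [ep eq]]; subst p' q; move: r1' r2'.
    rewrite -!catA /= => r1' r2'.
    exact: (rewrites_diamond IH l l' r1 r2 r1' r2').
- case: (rise_overlap (esym e) le_pp').
  + move=> [ep ex ey eq]; move: r1' r2'; rewrite ep ex ey eq => r1' r2'.
    rewrite (IH _ _ _ (rank_join _ _ _ _) r1 r1').
    by rewrite (IH _ _ _ (rank_swap _ _ l.1) r2 r2').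
  + by move=> [ep ex]; case: (overlap _ _ _ y l'); rewrite -ep -ex.
  + move=> [r [ep eq]]; subst p q'; move: r1 r2 IH.
    rewrite -!catA /= => r1 r2 IH; symmetry.
    exact: (rewrites_diamond IH l' l r1' r2' r1 r2).
Qed.

Definition rewrite_count s : nat := projT1 (cid (rewrites_total s)).

Lemma rewrite_countP s n : rewrites s n -> rewrite_count s = n.
Proof. exact/rewrites_fun/(projT2 (cid (rewrites_total s))). Qed.

Lemma rewrite_count_step p x y q : legal_rise p x y ->
  rewrite_count (p ++ x :: y :: q) =
    (rewrite_count (p ++ Node x y :: q) + rewrite_count (p ++ y :: x :: q))%N.
Proof.
move=> l; apply: rewrite_countP; apply: RewritesStep => //.
  exact: (projT2 (cid (rewrites_total _))).
exact: (projT2 (cid (rewrites_total _))).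
Qed.

Lemma rewrite_count1 c : rewrite_count [:: c] = (c == b).
Proof.
apply: rewrite_countP.
have -> : (c == b) = ([:: c] == [:: b]) by rewrite eqseq_cons andbT.
by apply: RewritesNormal => -[|z [|z' p]].
Qed.

End Rewriting.

(* The sequence is read from right to left. *)
Fixpoint standard (r : seq (br X)) : Prop :=
  if r is h :: r' then
    [/\ B h, is_leaf h \/ forall z, z \in r' -> le (lambda h) z & standard r']
  else True.

Lemma standard_mem r z : standard r -> z \in r -> B z.
Proof.
elim: r => //= h r IH [Bh _ sr]; rewrite inE => /orP[/eqP->//|]; exact: IH.
Qed.

(** A termination measure: splitting [Node x y] into x, y lowers its sum over the sequence by one,
    as does moving a leaf to the word; [leaves] would not detect the split. *)
Fixpoint br_nodes (t : br X) : nat :=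
  if t is Node x y then (br_nodes x + br_nodes y).+1 else 1%N.

Lemma lambda_lt t : B t -> ~ is_leaf t -> B (lambda t) /\ lt (lambda t) t.
Proof.
case: t => [x|x y] Bt nl; first by case: nl; exists x.
have [Bx By xy _] := hall_nodeP Bt.
by split=> //=; apply: (hall_lt_node hB).
Qed.

Lemma is_leafP (t : br X) : is_leaf t \/ ~ is_leaf t.
Proof. by case: t => [x|x y]; [left; exists x | right => -[]]. Qed.

(* The rightmost non-leaf [Node x y] of a standard sequence can be expanded
   into the legal rise [x; y]; both resulting sequences are standard. *)
Lemma coord_standard b (A : pzRingType) (V : pzRingType) (E : br X -> A)
    (W : seq X -> A) (Phi : {additive A -> V}) :
  (forall x y, E (Node x y) = E x * E y - E y * E x) ->
  (forall x w, W (x :: w) = E (Leaf x) * W w) ->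
  (forall w, Phi (W w) = (rewrite_count b (map (@Leaf X) w))%:R) ->
  forall r w, standard r ->
  Phi (\prod_(t <- rev r) E t * W w) =
    (rewrite_count b (rev r ++ map (@Leaf X) w))%:R.
Proof.
move=> E_node W_cons Phi_W r w.
have [k] := ubnP (sumn (map br_nodes r)).
elim: k r w => // k IH [|[x|x y] r] w; rewrite ltnS => rk.
- by move=> _; rewrite big_nil mul1r Phi_W.
- move=> [_ _ sr]; rewrite rev_cons big_rcons /= -mulrA cat_rcons.
  by rewrite -W_cons (IH r (x :: w)).
- move=> [Bxy lr sr].
  have [Bx By xy lyx] := hall_nodeP Bxy.
  (* As x is the left factor of [Node x y], standardness is what makes x, y a legal rise after
     [rev r]. *)
  have xr z : z \in r -> le x z.
    by case: lr => [[]//|lr]; apply: lr.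
  have lx : is_leaf x \/ forall z, z \in r -> le (lambda x) z.
    have [|nl] := is_leafP x; [by left|right => z zr].
    have [Blx llx] := lambda_lt Bx nl; left.
    exact: lt_le_hall Blx Bx (standard_mem sr zr) llx (xr _ zr).
  have ly : is_leaf y \/ forall z, z \in r -> le (lambda y) z.
    have [|nl] := is_leafP y; [by left|right => z zr].
    have [Bly _] := lambda_lt By nl.
    case: lyx => // lyx.
    exact: le_trans_hall Bly Bx (standard_mem sr zr) lyx (xr _ zr).
  have s1 : standard [:: y, x & r].
    split=> //; case: ly lyx => [|ly]; first by left.
    move=> [|lyx]; [by left|right => z]; rewrite inE => /orP[/eqP->//|]; exact: ly.
  have s2 : standard [:: x, y & r].
    split=> //; case: lx => [|lx]; [by left|].
    have [|nl] := is_leafP x; [by left|right => z].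
    have [Blx llx] := lambda_lt Bx nl.
    rewrite inE => /orP[/eqP->|]; last exact: lx.
    by left; apply: (hall_lt_trans hB Blx Bx By).
  have l : legal_rise (rev r) x y.
    by split=> // z; rewrite mem_rev; apply: xr.
  have e1 := IH [:: y, x & r] w _ s1; have e2 := IH [:: x, y & r] w _ s2.
  move: e1 e2; rewrite !rev_cons !big_rcons /= !cat_rcons.
  rewrite (rewrite_count_step _ _ l) natrD.
  set P := \prod_(t <- _) _ => e1 e2.
  (* The commutator subtracts the count of the swapped sequence, which [rewrite_count_step] has just
     added. *)
  have -> : P * E (Node x y) * W w = P * E x * E y * W w - P * E y * E x * W w.
    by rewrite E_node mulrBr mulrBl !mulrA.
  rewrite raddfB e1; last by move: rk => /=; lia.
  rewrite e2; last by move: rk => /=; lia.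
  exact: addrK.
Qed.

(** * Coordinate functionals on noncommutative polynomials *)

Section WordCoord.
Variables (K : fieldType) (b : br X).
Local Notation word := {fmonom {classic X}}.

Definition word_letter (x : X) : commutator_lie K word :=
  mkmalgU (FMonom [:: x : {classic X}]) 1.

Definition word_of (w : seq X) : {malg K[word]} :=
  mkmalgU (FMonom (w : seq {classic X})) 1.

Definition word_ev (t : br X) : {malg K[word]} := ev word_letter t.

(** The linear extension of the count from words to polynomials; on the polynomials of Hall elements
    it is the functional dual to [b]. *)
Definition word_coord : commutator_lie K word -> K :=
  mmap idfun
    (fun w : word => (rewrite_count b (map (@Leaf X) (w : seq {classic X})))%:R).

Lemma word_of_cons x w : word_of (x :: w) = word_ev (Leaf x) * word_of w.
Proof.
rewrite malgM_def fgmulUU mulr1; congr (mkmalgU _ 1).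
by apply: val_inj; rewrite /= fmM.
Qed.

Lemma word_coord_word w :
  word_coord (word_of w) = (rewrite_count b (map (@Leaf X) w))%:R.
Proof. by rewrite /word_coord mmapU mul1r. Qed.

Fact word_coord_is_scalable : scalable_for *%R word_coord.
Proof.
move=> k f; rewrite /word_coord (mmapEw (msuppZ_le k f)) mmapE mulr_sumr.
by apply: eq_bigr => w _; rewrite mcoeffZ mulrA.
Qed.

Fact word_coord_is_additive : zmod_morphism word_coord.
Proof. exact: mmap_is_additive. Qed.

HB.instance Definition _ := GRing.isZmodMorphism.Build (commutator_lie K word) K
  word_coord word_coord_is_additive.
HB.instance Definition _ := GRing.isScalable.Build K (commutator_lie K word) K
  *%R word_coord word_coord_is_scalable.

Lemma word_coord_ev c : B c -> word_coord (word_ev c) = (c == b)%:R.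
Proof.
move=> Bc.
have := @coord_standard b {malg K[word]} K word_ev word_of word_coord
  _ _ _ [:: c] [::].
rewrite big_seq1 rewrite_count1 => <- //=.
- have -> : word_of [::] = 1.
    by rewrite -[RHS]/(mkmalgU _ _); congr mkmalgU; apply: val_inj; rewrite /= fm1.
  by rewrite mulr1.
- exact: word_of_cons.
- exact: word_coord_word.
- by split=> //; right.
Qed.

End WordCoord.

Section Coordinates.
Variables (K : numFieldType) (L : lieAlgType K) (iota : X -> L).
Hypothesis hL : free_lie iota.

(** The universal property maps [L] to the commutator algebra of polynomials, where [word_coord c]
    reads off the coefficient of the Hall element c. *)
Lemma hall_coords_unique u alpha beta :
  hall_coords iota B u alpha -> hall_coords iota B u beta -> alpha = beta.
Proof.
have [phi [phi_lie phi_iota _]] := hL (word_letter K).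
have phi_ev t : phi (ev iota t) = ev (word_letter K) t.
  by elim: t => [x|x IHx y IHy] /=; [exact: phi_iota | rewrite phi_lie IHx IHy].
have coord (gamma : {fsfun br X -> K with 0}) c : B c ->
    hall_coords iota B u gamma -> word_coord c (phi u) = gamma c.
  move=> Bc [Bg ->]; rewrite !linear_sum /=.
  have coord_ev d : d \in finsupp gamma ->
      word_coord c (phi (gamma d *: ev iota d)) = gamma d * (d == c)%:R.
    by move=> dg; rewrite !linearZ /= phi_ev word_coord_ev //; apply: Bg.
  rewrite (eq_big_seq _ coord_ev).
  have [cg|cg] := boolP (c \in finsupp gamma); last first.
    rewrite fsfun_dflt // big_seq big1 // => d dg.
    by case: eqP => [e|_]; [rewrite -e dg in cg | rewrite mulr0].
  rewrite (bigD1_seq c cg (fset_uniq _)) /= eqxx mulr1 big1 ?addr0 // => d /negPf ->.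
  by rewrite mulr0.
move=> ha hb; apply/fsfunP => c; have [Bc|nBc] := pselect (B c).
  by rewrite -(coord _ _ Bc ha) -(coord _ _ Bc hb).
rewrite !fsfun_dflt //; apply/negP.
  by move/(proj1 hb).
by move/(proj1 ha).
Qed.

End Coordinates.

End HallBasis.

(** * The norm of an expansion on the Hall basis *)

Section LieTheory.
Variables (K : fieldType) (L : lieAlgType K).
Implicit Types u v w : L.

HB.instance Definition _ (u : L) :=
  GRing.isLinear.Build K L L *:%R (lie u) (lie_linear_r u).

Lemma lieDl u v w : lie (u + v) w = lie u w + lie v w.
Proof. by have := lie_linear_l w 1 u v; rewrite !scale1r. Qed.

Lemma lieC u v : lie u v = - lie v u.
Proof.
have := lie_alternating (u + v); rewrite lieDl !linearD /= !lie_alternating.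
by rewrite add0r addr0 => /eqP; rewrite addr_eq0 => /eqP.
Qed.

Lemma lie_derivation u v w : lie u (lie v w) = lie (lie u v) w + lie v (lie u w).
Proof.
have := lie_jacobi u v w.
rewrite (lieC w (lie u v)) (lieC w u) linearN /= => /eqP.
by rewrite -addrA addr_eq0 opprD !opprK addrC => /eqP.
Qed.

(** [lie x] is a derivation, so the induction is that of the binomial theorem, with Pascal's
    rule. *)
Lemma leibniz x n u v :
  iter n (lie x) (lie u v) =
    \sum_(j < n.+1) lie (iter (n - j) (lie x) u) (iter j (lie x) v) *+ 'C(n, j).
Proof.
pose G i j := lie (iter i (lie x) u) (iter j (lie x) v).
have DG i j : lie x (G i j) = G i.+1 j + G i j.+1 by rewrite /G lie_derivation.
suff -> : iter n (lie x) (G 0%N 0%N) =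
    \sum_(j < n.+1) G (n - j)%N j *+ 'C(n, j) by [].
elim: n => [|n IH]; first by rewrite big_ord1.
rewrite iterS IH linear_sum /=.
have step (j : 'I_n.+1) :
    lie x (G (n - j)%N j *+ 'C(n, j)) =
    G (n.+1 - j)%N j *+ 'C(n, j) + G (n - j)%N j.+1 *+ 'C(n, j).
  by rewrite linearMn /= DG mulrnDl subSn // -ltnS.
rewrite (eq_bigr _ (fun j _ => step j)).
rewrite big_split /= [in RHS]big_ord_recl.
under [in RHS]eq_bigr => j _ do rewrite lift0 subSS binS mulrnDr.
rewrite big_split /= addrA; congr (_ + _).
rewrite big_ord_recl /= !bin0 !subn0; congr (_ + _).
rewrite [in RHS]big_ord_recr /= bin_small // mulr0n addr0.
by apply: eq_bigr => j _; rewrite /bump leq0n add1n subSS.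
Qed.

End LieTheory.

Lemma uniq_map_inj (S T : eqType) (f : S -> T) (s : seq S) :
  uniq (map f s) -> {in s &, injective f}.
Proof.
elim: s => //= x s IH /andP[xs us] p q; rewrite !inE.
move=> /orP[/eqP->|ps] /orP[/eqP->|qs] // e; last exact: IH e.
- by rewrite e map_f in xs.
- by rewrite -e map_f in xs.
Qed.

Section HallNorm.
Variables (X : Type) (B : set (br X)) (lt : br X -> br X -> Prop).
Hypothesis hB : hall_set B lt.
Variables (K : numFieldType) (L : lieAlgType K) (iota : X -> L).
Hypothesis hL : free_lie iota.

Section Expansion.
Variables (u : L) (s : seq (K * br X)).
Hypothesis Bs : forall p, p \in s -> B p.2.
Hypothesis us : u = \sum_(p <- s) p.1 *: ev iota p.2.

Let F : {fset br X} := [fset c in map snd s]%fset.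

Let collect (V : zmodType) (G : K * br X -> V) :
  \sum_(c <- F) \sum_(p <- s | p.2 == c) G p = \sum_(p <- s) G p.
Proof.
rewrite (exchange_big_dep xpredT) //= big_seq [RHS]big_seq.
apply: eq_bigr => p ps; rewrite (eq_bigl (pred1 p.2)) => [|c]; last by rewrite eq_sym.
rewrite -big_filter filter_pred1_uniq ?fset_uniq ?big_seq1 //.
by rewrite !inE; apply: map_f.
Qed.

Let coords : {fsfun br X -> K with 0} :=
  [fsfun c in F => \sum_(p <- s | p.2 == c) p.1].

Let coordsE c : coords c = \sum_(p <- s | p.2 == c) p.1.
Proof.
rewrite fsfunE; case: ifP => // /negP cF; rewrite big_seq_cond big1 // => p.
by move=> /andP[ps /eqP pc]; case: cF; rewrite !inE -pc; apply: map_f.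
Qed.

Let finsupp_coords : (finsupp coords `<=` F)%fset.
Proof. exact: finsupp_sub. Qed.

Let hall_coords_coords : hall_coords iota B u coords.
Proof.
split=> [c /(fsubsetP finsupp_coords)|].
  by rewrite !inE => /mapP[p ps ->]; apply: Bs.
rewrite (big_fset_incl _ finsupp_coords) => [|c _ /fsfun_dflt->]; last first.
  by rewrite scale0r.
rewrite us -collect; apply: eq_bigr => c _; rewrite coordsE scaler_suml.
by apply: eq_bigr => p /eqP->.
Qed.

Let hall_normE : hall_norm iota B u = \sum_(c <- F) `|coords c|.
Proof.
(* [hall_coord] is an arbitrary choice; uniqueness identifies it with [coords]. *)
rewrite /hall_norm; have -> : hall_coord iota B u = coords.
  apply: (hall_coords_unique hB hL) hall_coords_coords.
  exact: (@xgetPex _ _ [set alpha | hall_coords iota B u alpha]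
    (ex_intro _ _ hall_coords_coords)).
by rewrite (big_fset_incl _ finsupp_coords) // => c _ /fsfun_dflt->; rewrite normr0.
Qed.

(** A Hall element may occur several times in [s], whence a triangle inequality. *)
Lemma hall_norm_le_expansion : hall_norm iota B u <= \sum_(p <- s) `|p.1|.
Proof.
rewrite hall_normE -(collect (fun p => `|p.1|)); apply: ler_sum => c _.
by rewrite coordsE ler_norm_sum.
Qed.

(** Each Hall element collects a single term, so nothing cancels. *)
Lemma hall_norm_expansion : uniq (map snd s) ->
  hall_norm iota B u = \sum_(p <- s) `|p.1|.
Proof.
move=> us'; rewrite hall_normE -(collect (fun p => `|p.1|)).
rewrite big_seq [RHS]big_seq; apply: eq_bigr => c; rewrite !inE => /mapP[p ps ->].
rewrite coordsE -big_filter -[in RHS]big_filter.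
have -> : [seq q <- s | q.2 == p.2] = [:: p]; last by rewrite !big_seq1.
have/(filter_pred1_uniq (map_uniq us')) <- := ps.
apply: eq_in_filter => q qs /=; apply/eqP/eqP => [e|->//].
exact: (uniq_map_inj us' qs ps e).
Qed.

End Expansion.
End HallNorm.

(** * Upper bounds *)

Section SignedSums.
Variables (X : Type) (K : numFieldType) (L : lieAlgType K) (iota : X -> L).
Implicit Types (P Q : br X -> Prop) (u v : L).

(** The boolean is the exponent of the sign. Repetitions are allowed and [n] is an upper bound,
    which makes the notion stable under sums and linear maps. *)
Definition signed_sum P (n : nat) u : Prop :=
  exists s : seq (bool * br X),
    [/\ (size s <= n)%N, forall p, p \in s -> P p.2
      & u = \sum_(p <- s) (-1) ^+ p.1 *: ev iota p.2].

Lemma signed_sum0 P n : signed_sum P n 0.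
Proof. by exists [::]; rewrite big_nil. Qed.

Lemma signed_sum0_eq0 P u : signed_sum P 0 u -> u = 0.
Proof. by move=> [[|p s] [//= _ _ ->]]; rewrite big_nil. Qed.

Lemma signed_sum_ev P c e : P c ->
  signed_sum P 1 ((-1) ^+ (e : bool) *: ev iota c).
Proof.
move=> Pc; exists [:: (e, c)]; rewrite big_seq1.
by split=> // p; rewrite inE => /eqP->.
Qed.

Lemma signed_sum_ev1 P n c : P c -> (0 < n)%N -> signed_sum P n (ev iota c).
Proof.
move=> Pc n0; exists [:: (false, c)]; rewrite big_seq1 expr0 scale1r.
by split=> // p; rewrite inE => /eqP->.
Qed.

Lemma signed_sumD P m n u v :
  signed_sum P m u -> signed_sum P n v -> signed_sum P (m + n) (u + v).
Proof.
move=> [s [sm Ps ->]] [t [tn Pt ->]]; exists (s ++ t); rewrite size_cat big_cat.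
split=> [||//]; first exact: leq_add.
by move=> p; rewrite mem_cat => /orP[/Ps|/Pt].
Qed.

Lemma signed_sum_sign P n u e :
  signed_sum P n u -> signed_sum P n ((-1) ^+ (e : bool) *: u).
Proof.
move=> [s [sn Ps ->]]; exists [seq (e (+) p.1, p.2) | p <- s]; rewrite size_map.
split=> // [p /mapP[q qs ->]|]; first exact: (Ps _ qs).
rewrite big_map scaler_sumr; apply: eq_bigr => p _ /=.
by rewrite scalerA signr_addb.
Qed.

Lemma signed_sumN P n u : signed_sum P n u -> signed_sum P n (- u).
Proof. by move/(signed_sum_sign true); rewrite expr1 scaleN1r. Qed.

Lemma signed_sum_sub P Q m n u : (forall c, P c -> Q c) -> (m <= n)%N ->
  signed_sum P m u -> signed_sum Q n u.
Proof.
move=> PQ mn [s [sm Ps ->]]; exists s; split=> // [|p /Ps/PQ//].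
exact: leq_trans mn.
Qed.

Lemma signed_sum_linear P Q m n u (f : {linear L -> L}) :
  (forall c, P c -> signed_sum Q m (f (ev iota c))) ->
  signed_sum P n u -> signed_sum Q (n * m) (f u).
Proof.
move=> fPQ [s [sn Ps ->]]; rewrite linear_sum /=.
apply: (@signed_sum_sub Q _ (size s * m)) => //; first by rewrite leq_mul2r sn orbT.
elim: s Ps {sn} => [|p s IH] Ps; first by rewrite big_nil; apply: signed_sum0.
rewrite big_cons mulSn; apply: signed_sumD.
  by rewrite linearZ; apply/signed_sum_sign/fPQ/Ps/mem_head.
by apply: IH => q qs; apply: Ps; rewrite inE qs orbT.
Qed.

Lemma hall_norm_signed_sum (B : set (br X)) lt (hB : hall_set B lt)
  (hL : free_lie iota) P n u : (forall c, P c -> B c) -> signed_sum P n u ->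
  hall_norm iota B u <= n%:R.
Proof.
move=> PB [s [sn Ps ->]].
pose t := [seq ((-1) ^+ (p.1 : bool) : K, p.2) | p <- s].
have Bt p : p \in t -> B p.2 by move=> /mapP[q qs ->]; apply/PB/(Ps _ qs).
have et : \sum_(p <- s) (-1) ^+ p.1 *: ev iota p.2 =
    \sum_(p <- t) p.1 *: ev iota p.2 by rewrite big_map.
apply: le_trans (hall_norm_le_expansion hB hL Bt et) _.
rewrite big_map; under eq_bigr => p _ do rewrite normr_sign.
by rewrite big_const_seq count_predT iter_addr addr0 ler_nat.
Qed.
End SignedSums.

(** * Decomposition of a bracket of two Hall elements *)

Section Bounds.
Variables (X : Type) (B : set (br X)) (lt : br X -> br X -> Prop).
Hypotheses (hB : hall_set B lt) (hlen : length_compatible B lt).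
Variables (K : numFieldType) (L : lieAlgType K) (iota : X -> L).
Local Notation le a b := (lt a b \/ a = b).

(** For d < t in [B], this is the condition for [Node d t] to be in [B]. *)
Definition lambda_le d t := is_leaf t \/ le (lambda t) d.

Lemma leaves_gt0 (t : br X) : (0 < leaves t)%N.
Proof. by elim: t => //= x IHx y IHy; lia. Qed.

Lemma lt_leaves a b : B a -> B b -> (leaves a < leaves b)%N -> lt a b.
Proof.
move=> Ba Bb; case: (hall_lt_total hB Ba Bb) => // [->|/(hlen Bb Ba)]; lia.
Qed.

Lemma le_or_gt a b : B a -> B b -> le a b \/ lt b a.
Proof.
by move=> Ba Bb; case: (hall_lt_total hB Ba Bb); [left; left|left; right|right].
Qed.

Lemma lambda_le_self b : B b -> lambda_le b b.
Proof.
move=> Bb; have [|nl] := is_leafP b; [by left | right; left].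
by case: (lambda_lt hB Bb nl).
Qed.

Lemma lambda_le_trans d d' t : B d -> B d' -> B t -> le d d' ->
  lambda_le d t -> lambda_le d' t.
Proof.
move=> Bd Bd' Bt dd' h; have [|nl] := is_leafP t; [by left|right].
case: h => // h; have [Bl _] := lambda_lt hB Bt nl.
exact: (le_trans_hall hB Bl Bd Bd').
Qed.

Lemma hall_node_in x y : B x -> B y -> lt x y -> lambda_le x y -> B (Node x y).
Proof. by move=> Bx By xy lyx; apply/(hall_node hB). Qed.

Definition hall_pair x y : br X := if `[< lt x y >] then Node x y else Node y x.

(** As d bounds both left factors and lies below x and y, the smaller of x and y bounds the left
    factor of the larger. *)
Lemma hall_pairP d x y : B d -> B x -> B y -> lt d x -> lt d y ->
  lambda_le d x -> lambda_le d y -> x <> y ->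
  B (hall_pair x y) /\
  lie (ev iota x) (ev iota y) =
    (-1) ^+ (~~ `[< lt x y >]) *: ev iota (hall_pair x y).
Proof.
move=> Bd Bx By dx dy lx ly xy; rewrite /hall_pair; case: asboolP => [ltxy|nlt] /=.
  rewrite expr0 scale1r; split=> //; apply: hall_node_in => //.
  by apply: (lambda_le_trans Bd) ly => //; left.
rewrite expr1 scaleN1r -lieC; split=> //; apply: hall_node_in => //.
  by case: (hall_lt_total hB Bx By).
by apply: (lambda_le_trans Bd) lx => //; left.
Qed.

(** The bound is on the left factors of both children: if d < x < y, then (d, x) and (d, y) are Hall
    elements and the Leibniz rule can be applied. *)
Definition lambda_pair d n (c : br X) : Prop :=
  [/\ B c, leaves c = n &
      exists x y, [/\ c = Node x y, lambda_le d x & lambda_le d y]].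

Lemma lambda_pair_lie d x y : B d -> B x -> B y -> lt d x -> lt d y ->
  lambda_le d x -> lambda_le d y ->
  signed_sum iota (lambda_pair d (leaves x + leaves y)) 1
    (lie (ev iota x) (ev iota y)).
Proof.
move=> Bd Bx By dx dy lx ly.
have [->|xy] := pselect (x = y).
  by rewrite lie_alternating; apply: signed_sum0.
have [Bxy ->] := hall_pairP Bd Bx By dx dy lx ly xy.
apply: signed_sum_ev; split=> //; rewrite /hall_pair; case: ifP => _ //=.
- by rewrite addnC.
- by exists x, y.
- by exists y, x.
Qed.

Lemma lambda_pair_sub d d' n c : B d -> B d' -> le d d' ->
  lambda_pair d n c -> lambda_pair d' n c.
Proof.
move=> Bd Bd' dd' [Bc cn [x [y [e lx ly]]]]; split=> //.
exists x, y; have [Bx By _ _] : [/\ B x, B y, lt x y & lambda_le x y].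
  by apply/(hall_node hB); rewrite -e.
by split=> //; apply: (lambda_le_trans Bd Bd').
Qed.

(* If [d < x], both terms of the Leibniz rule for [[d, [x, y]]] are brackets of
   elements above [d] with left factors at most [d]; otherwise [(d, (x, y))] is
   already a Hall element. *)
Lemma lambda_pair_step d n c : B d -> lambda_pair d n c -> (leaves d < n)%N ->
  signed_sum iota (lambda_pair d (leaves d + n)) 2 (lie (ev iota d) (ev iota c)).
Proof.
move=> Bd [Bc cn [x [y [e lx ly]]]] dn; subst c n.
have [Bx By xy lyx] : [/\ B x, B y, lt x y & lambda_le x y].
  by apply/(hall_node hB).
have ld := lambda_le_self Bd.
have [xd|dx] := le_or_gt Bx Bd.
  have Bdc : B (Node d (Node x y)).
    by apply: hall_node_in => //; [exact: lt_leaves | right].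
  apply: (@signed_sum_ev1 _ _ _ iota _ _ (Node d (Node x y))) => //.
  by split=> //; exists d, (Node x y); split=> //; right.
have dy : lt d y by apply: (hall_lt_trans hB Bd Bx By).
have Bdx : B (Node d x) by apply: hall_node_in.
have Bdy : B (Node d y) by apply: hall_node_in.
rewrite [ev _ (Node x y)]/= lie_derivation; apply: (@signed_sumD _ _ _ _ _ 1 1).
  rewrite [leaves (Node x y)]/= addnA.
  apply: (@lambda_pair_lie d (Node d x) y) => //; first exact: (hall_lt_node hB).
  by right; right.
rewrite [leaves (Node x y)]/= addnCA.
apply: (@lambda_pair_lie d x (Node d y)) => //; first exact: (hall_lt_node hB).
by right; right.
Qed.

(* [a, b] is a single Hall element [s], which can be bracketed further as
   freely as [b] itself, plus [N] signed Hall elements. *)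
Definition bracket_decomposition a b (N : nat) : Prop :=
  exists s r, [/\ lie (ev iota a) (ev iota b) = ev iota s + r,
    B s /\ leaves s = (leaves a + leaves b)%N,
    N = 0%N \/ (leaves a < leaves b)%N &
    forall d, B d -> lambda_le d b -> lt a d ->
      lambda_le d s /\ signed_sum iota (lambda_pair d (leaves a + leaves b)) N r].

Lemma bracket_decomposition_node a b : B (Node a b) ->
  bracket_decomposition a b 0.
Proof.
move=> Bab; exists (Node a b), 0; split=> //.
- by rewrite addr0.
- by left.
move=> d Bd lbd ad; split; last exact: signed_sum0.
by right; left.
Qed.

(** The Leibniz rule gives [[a, b], [a, b]] + [b, [a, [a, b]]], whose first term vanishes;
    [bracket_decomposition_step] would count an extra term here. *)
Lemma bracket_decomposition_self a b : lt a b -> B (Node b (Node a b)) ->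
  bracket_decomposition a (Node b (Node a b)) 0.
Proof.
move=> ab Bbab; have [Bb Bab _ _] := hall_nodeP hB Bbab.
have [Ba _ _ _] := hall_nodeP hB Bab.
have leb := leaves_gt0 b; have lea := leaves_gt0 a.
exists (Node b (Node a (Node a b))), 0; split.
- by rewrite /= lie_derivation lie_alternating add0r addr0.
- split; last by rewrite /=; lia.
  have Baab : B (Node a (Node a b)).
    apply: hall_node_in => //; last by right; right.
    exact: (hall_lt_node hB).
  apply: hall_node_in => //; last by right; left.
  by apply: lt_leaves => //=; lia.
- by left.
move=> d Bd [[]//|/= bd] ad; split; last exact: signed_sum0.
by right.
Qed.

Lemma bracket_decomposition_step a b1 b2 N1 N2 :
  B a -> B (Node b1 b2) -> lt a b1 ->
  bracket_decomposition a b1 N1 -> bracket_decomposition a b2 N2 ->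
  bracket_decomposition a (Node b1 b2) (N1.+1 + N2 * 2).
Proof.
move=> Ba Bb ab1 [s1 [r1 [e1 [Bs1 ls1] N1a h1]]] [s2 [r2 [e2 [Bs2 ls2] _ h2]]].
have [B1 B2 b12 lb12] := hall_nodeP hB Bb.
have ab2 := hall_lt_trans hB Ba B1 B2 ab1 b12.
have lea := leaves_gt0 a.
have lab1 := hlen Ba B1 ab1; have lab2 := hlen B1 B2 b12.
(* Both decompositions are used at d = b1, which is above a and bounds the left factors of b1 and
   b2. *)
have [ls1b sr1] := h1 _ B1 (lambda_le_self B1) ab1.
have [ls2b sr2] := h2 _ B1 lb12 ab1.
have Bs : B (Node b1 s2).
  by apply: hall_node_in => //; apply: lt_leaves => //; lia.
exists (Node b1 s2),
  (lie (lie (ev iota a) (ev iota b1)) (ev iota b2) + lie (ev iota b1) r2).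
split.
- by rewrite [ev _ (Node b1 b2)]/= lie_derivation e2 linearD /= addrCA.
- by split=> //=; lia.
- by right=> /=; lia.
move=> d Bd [[]//|/= b1d] ad; split; first by right.
(* The remainder is controlled at b1, then at d because b1 <= d. *)
apply: (@signed_sum_sub _ _ _ _
  (lambda_pair b1 (leaves a + (leaves b1 + leaves b2))) _ _ _ _ _ (leqnn _)).
  by move=> c; apply: lambda_pair_sub.
apply: signed_sumD; last first.
  apply: (signed_sum_linear (f := lie (ev iota b1))) sr2 => c Pc.
  by rewrite addnCA; apply: lambda_pair_step => //; lia.
pose P c := [/\ B c, lambda_le b1 c & leaves c = (leaves a + leaves b1)%N].
have sP : signed_sum iota P N1.+1 (lie (ev iota a) (ev iota b1)).
  rewrite e1 -add1n; apply: signed_sumD.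
    exact: signed_sum_ev1.
  (* When |a| < |b1|, the left factor of c has at most half of the |a| + |b1| leaves, hence fewer
     than |b1|. *)
  case: N1a => [N10|lab].
    by move: sr1; rewrite N10 => /signed_sum0_eq0 ->; apply: signed_sum0.
  apply: signed_sum_sub (leqnn _) sr1 => c [Bc lc [x [y [ec _ _]]]]; split=> //.
  subst c; have [Bx By xy _] := hall_nodeP hB Bc.
  right; left; apply: lt_leaves => //=.
  by have := hlen Bx By xy; move: lc => /=; lia.
rewrite lieC; apply: signed_sumN.
rewrite -[N1.+1]muln1.
apply: (signed_sum_linear (f := lie (ev iota b2))) sP => c [Bc lc ec].
rewrite /= lieC; apply: signed_sumN.
rewrite addnA -ec; apply: lambda_pair_lie => //.
by apply: lt_leaves => //; lia.
Qed.

Lemma bracket_decomposition_norm a b N :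
  free_lie iota -> B a -> B b -> lt a b ->
  bracket_decomposition a b N ->
  hall_norm iota B (lie (ev iota a) (ev iota b)) <= N.+1%:R.
Proof.
move=> hL Ba Bb ab [s [r [-> [Bs _] _ h]]].
have [_ sr] := h _ Bb (lambda_le_self Bb) ab.
apply: (hall_norm_signed_sum hB hL (P := B)) => //; rewrite -add1n.
apply: signed_sumD.
  exact: signed_sum_ev1.
by apply: signed_sum_sub (leqnn _) sr => c [].
Qed.

Lemma bracket_decomposition_exists a b : B a -> B b -> lt a b ->
  exists2 N, bracket_decomposition a b N & (N.+1 <= 2 ^ (leaves b - 1))%N.
Proof.
elim: b a => [x|b1 IH1 b2 IH2] a Ba Bb ab.
  exists 0%N => //; apply: bracket_decomposition_node.
  by apply: hall_node_in => //; left; exists x.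
have [B1 B2 b12 _] := hall_nodeP hB Bb.
have [b1a|ab1] := le_or_gt B1 Ba.
  exists 0%N; last by rewrite expn_gt0.
  by apply: bracket_decomposition_node; apply: hall_node_in => //; right.
have [N1 d1 l1] := IH1 _ Ba B1 ab1.
have [N2 d2 l2] := IH2 _ Ba B2 (hall_lt_trans hB Ba B1 B2 ab1 b12).
exists (N1.+1 + N2 * 2)%N; first exact: bracket_decomposition_step.
(* With p = 2^(|b1| - 1) and q = 2^(|b2| - 1), the total is at most p + 2q - 1, and 2pq - (p + 2q -
   1) = (p - 1)(2q - 1) >= 0. *)
have := leaves_gt0 b1; have := leaves_gt0 b2; rewrite /=.
move: l1 l2; case: (leaves b1) (leaves b2) => [//|m] [//|k].
rewrite addSn addnS !subSS !subn0 expnS expnD.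
have : (0 < 2 ^ m)%N by rewrite expn_gt0.
have : (0 < 2 ^ k)%N by rewrite expn_gt0.
nia.
Qed.

(** * The sharper bound for two letters *)

Section TwoLetters.
Variables x0 x1 : X.
Hypotheses (x01 : lt (Leaf x0) (Leaf x1)) (two : forall x, x = x0 \/ x = x1).

Lemma leaves_eq1 (t : br X) : leaves t = 1%N -> exists x, t = Leaf x.
Proof.
case: t => [x|x y] /=; first by exists x.
by have := leaves_gt0 x; have := leaves_gt0 y; lia.
Qed.

Lemma two_letters_leaf t : leaves t = 1%N -> t = Leaf x0 \/ t = Leaf x1.
Proof. by move=> /leaves_eq1[x ->]; case: (two x) => ->; [left|right]. Qed.

Lemma two_letters_lt x y : B x -> B y -> lt x y ->
  leaves x = 1%N -> leaves y = 1%N ->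
  x = Leaf x0 /\ y = Leaf x1.
Proof.
move=> Bx By xy lx ly; have B0 := hall_leaf hB x0; have B1 := hall_leaf hB x1.
case: (two_letters_leaf lx) (two_letters_leaf ly) xy => -> [] -> // h.
- by case: (hall_lt_irr hB B0).
- by case: (hall_lt_irr hB B0 (hall_lt_trans hB B0 B1 B0 x01 h)).
- by case: (hall_lt_irr hB B1).
Qed.

Lemma two_letters_leaves2 t : B t -> leaves t = 2%N -> t = Node (Leaf x0) (Leaf x1).
Proof.
case: t => [//|x y] Bt /= e; have [Bx By xy _] := hall_nodeP hB Bt.
have := leaves_gt0 x; have := leaves_gt0 y => gy gx.
by have [-> ->] : x = Leaf x0 /\ y = Leaf x1 by apply: two_letters_lt => //; lia.
Qed.

(** The only left factor that can arise is x0, the least element of [B]. *)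
Lemma two_letters_short a b : B a -> B b -> lt a b -> (leaves b <= 2)%N ->
  B (Node a b).
Proof.
move=> Ba Bb ab lb; apply: hall_node_in => //.
case: b Bb ab lb => [x|x y] Bb ab lb; [by left; exists x | right].
have lb2 : leaves (Node x y) = 2%N.
  by apply/eqP; rewrite eqn_leq lb /=; have := leaves_gt0 x; have := leaves_gt0 y; lia.
have eb := two_letters_leaves2 Bb lb2; move: eb ab => [-> ->] ab /=.
case: (leqP (leaves a) 1) => la; last first.
  by left; apply: lt_leaves => //; apply: hall_leaf hB _.
have la1 : leaves a = 1%N by have := leaves_gt0 a; lia.
by have [->|->] := two_letters_leaf la1; [right | left].
Qed.

(** Truncated subtraction gives exponent 0 for |b| <= 3, so a single term is claimed there. If a <
    b1, either |b2| >= 3 and the general step applies, or a = x0 and b = (x1, (x0, x1)). *)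
Lemma bracket_decomposition_two_letters a b : B a -> B b -> lt a b ->
  exists2 N, bracket_decomposition a b N & (N.+1 <= 2 ^ (leaves b - 3))%N.
Proof.
elim: b a => [x|b1 IH1 b2 IH2] a Ba Bb ab.
  exists 0%N; last by rewrite expn_gt0.
  by apply: bracket_decomposition_node; apply: two_letters_short.
have [B1 B2 b12 lb12] := hall_nodeP hB Bb.
have [b1a|ab1] := le_or_gt B1 Ba.
  exists 0%N; last by rewrite expn_gt0.
  by apply: bracket_decomposition_node; apply: hall_node_in => //; right.
have ab2 := hall_lt_trans hB Ba B1 B2 ab1 b12.
have gb1 := leaves_gt0 b1; have gb2 := leaves_gt0 b2.
have l12 := hlen B1 B2 b12.
have [N1 d1 l1] := IH1 _ Ba B1 ab1; have [N2 d2 l2] := IH2 _ Ba B2 ab2.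
have [lb2|lb2] := leqP (leaves b2) 2.
  have {}lb2 : leaves b2 = 1%N \/ leaves b2 = 2%N by lia.
  have la := hlen Ba B1 ab1; have ga := leaves_gt0 a.
  (* If |b2| = 1, then a < b1 < b2 would be three distinct letters. *)
  case: lb2 => lb2.
    have [ea _] := two_letters_lt Ba B1 ab1 ltac:(lia) ltac:(lia).
    have [e1 _] := two_letters_lt B1 B2 b12 ltac:(lia) ltac:(lia).
    by case: (hall_lt_irr hB Ba); move: ab1; rewrite e1 -ea.
  have e2 := two_letters_leaves2 B2 lb2.
  have l1' : leaves b1 = 1%N.
    have [//|l1'] : leaves b1 = 1%N \/ leaves b1 = 2%N by lia.
    case: (hall_lt_irr hB B1); move: b12.
    by rewrite e2 -(two_letters_leaves2 B1 l1').
  have [ea e1] := two_letters_lt Ba B1 ab1 ltac:(lia) l1'.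
  exists 0%N; last by rewrite expn_gt0.
  rewrite e2 -ea -e1; apply: bracket_decomposition_self => //.
  by rewrite ea e1 -e2 -e1.
exists (N1.+1 + N2 * 2)%N; first exact: bracket_decomposition_step.
have p1 : (0 < 2 ^ (leaves b1 - 3))%N by rewrite expn_gt0.
have p2 : (0 < 2 ^ (leaves b2 - 3))%N by rewrite expn_gt0.
(* The exponents compare because |b1| >= 1 and |b2| >= 3; the rest is the inequality p + 2q - 1 <=
   2pq again. *)
have : (2 ^ (1 + (leaves b1 - 3) + (leaves b2 - 3)) <=
        2 ^ (leaves (Node b1 b2) - 3))%N by rewrite leq_exp2l //=; lia.
rewrite !expnD expn1; nia.
Qed.
End TwoLetters.
End Bounds.

(** * Optimality *)

(** Counting x0 separates D^i (x0, x1), where it occurs once, from D^j z. *)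
Fixpoint occurrences (X : Type) (x : X) (t : br X) : nat :=
  match t with
  | Leaf y => `[< y = x >]
  | Node t1 t2 => occurrences x t1 + occurrences x t2
  end.

Lemma leaves_iter_ad (X : Type) (x : X) n t :
  leaves (iter n (ad (Leaf x)) t) = (n + leaves t)%N.
Proof. by elim: n => //= n ->; rewrite add1n. Qed.

Lemma ev_iter_ad (X : Type) (K : fieldType) (L : lieAlgType K) (iota : X -> L)
  x n t :
  ev iota (iter n (ad (Leaf x)) t) = iter n (lie (iota x)) (ev iota t).
Proof. by elim: n => //= n ->. Qed.

Lemma occurrences_iter_ad (X : Type) (x y : X) n t : y <> x ->
  occurrences x (iter n (ad (Leaf y)) t) = occurrences x t.
Proof. by move=> yx; elim: n => //= n ->; case: asboolP. Qed.

Lemma iter_lieN (K : fieldType) (L : lieAlgType K) (x u : L) n :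
  iter n (lie x) (- u) = - iter n (lie x) u.
Proof. by elim: n => //= n ->; rewrite linearN. Qed.

Section AdChains.
Variables (X : Type) (B : set (br X)) (lt : br X -> br X -> Prop).
Hypotheses (hB : hall_set B lt) (hlen : length_compatible B lt).
Variables (K : numFieldType) (L : lieAlgType K) (iota : X -> L).
Hypothesis hL : free_lie iota.
Variables (x0 x1 : X) (z : br X).
Hypotheses (x01 : lt (Leaf x0) (Leaf x1)) (Bz : B z) (x1z : lt (Leaf x1) z).
Hypotheses (lz : lambda_le lt (Leaf x0) z) (oz : occurrences x0 z <> 1%N).

Let B0 : B (Leaf x0) := hall_leaf hB x0.
Let B1 : B (Leaf x1) := hall_leaf hB x1.
Let neq10 : x1 <> x0.
Proof. by move=> e; apply: (hall_lt_irr hB B0); move: x01; rewrite e. Qed.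
Let ad1 n t := iter n (ad (Leaf x1)) t.

Let ad1_hall n t : B t -> lt (Leaf x1) t -> lambda_le lt (Leaf x1) t ->
  [/\ B (ad1 n t), lt (Leaf x1) (ad1 n t) & lambda_le lt (Leaf x1) (ad1 n t)].
Proof.
move=> Bt ltt ly; elim: n => [//|n [Bn ln yn]].
have Bn1 : B (ad1 n.+1 t) by apply: (hall_node_in hB).
by split=> //; [apply: (hall_lt_node hB) | right; right].
Qed.

Let z_le1 : lambda_le lt (Leaf x1) z.
Proof. by apply: (lambda_le_trans hB B0 B1 Bz) => //; left. Qed.

Let x0z : lt (Leaf x0) z := hall_lt_trans hB B0 B1 Bz x01 x1z.

Let lt1_node t : B (Node (Leaf x0) t) -> lt (Leaf x1) (Node (Leaf x0) t).
Proof. by move=> Bt; apply: (lt_leaves hB hlen) => //=; have := leaves_gt0 t; lia. Qed.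

Let B01 : B (Node (Leaf x0) (Leaf x1)).
Proof. by apply: (hall_node_in hB) => //; left; exists x1. Qed.

Let B0z : B (Node (Leaf x0) z).
Proof. exact: (hall_node_in hB). Qed.

Let low n := ad1 n (Node (Leaf x0) (Leaf x1)).

Let low_hall n :
  [/\ B (low n), lt (Leaf x1) (low n) & lambda_le lt (Leaf x1) (low n)].
Proof. by apply: ad1_hall => //; [apply: lt1_node | right; left]. Qed.

Let high_hall n :
  [/\ B (ad1 n z), lt (Leaf x1) (ad1 n z) & lambda_le lt (Leaf x1) (ad1 n z)].
Proof. exact: ad1_hall. Qed.

Let low_neq_high i j : low i <> ad1 j z.
Proof.
move=> /(congr1 (occurrences x0)); rewrite !occurrences_iter_ad //= => e.
by apply: oz; rewrite -e; case: asboolP => // _; case: asboolP.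
Qed.

Let rest n j := hall_pair lt (low (n - j.+1)) (ad1 j z).

Let expansion n : seq (K * br X) :=
  (1, ad1 n (Node (Leaf x0) z)) ::
  [seq ((-1) ^+ (~~ `[< lt (low (n - j.+1)) (ad1 j z) >]) * 'C(n, j)%:R,
        rest n j) | j <- index_iota 0 n].

Let rest_hall n j : B (rest n j) /\
  lie (ev iota (low (n - j.+1))) (ev iota (ad1 j z)) =
  (-1) ^+ (~~ `[< lt (low (n - j.+1)) (ad1 j z) >]) *: ev iota (rest n j).
Proof.
have [Bl ltl ll] := low_hall (n - j.+1); have [Bh lth lh] := high_hall j.
exact: (hall_pairP hB iota B1).
Qed.

(** In the Leibniz formula for D^n [x0, z], the term j = n is the bracket sought; for j < n, D^(n-j)
    x0 = - D^(n-j-1) [x0, x1]. *)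
Let bracket_expansion n :
  lie (ev iota (Leaf x0)) (ev iota (ad1 n z)) =
  \sum_(p <- expansion n) p.1 *: ev iota p.2.
Proof.
have := leibniz (iota x1) n (iota x0) (ev iota z).
rewrite big_cons scale1r big_map big_mkord big_ord_recr /= subnn binn mulr1n.
rewrite /ad1 !ev_iter_ad /= => ->; rewrite addrAC -big_split /= big1 ?add0r //.
move=> j _; have [_ e] := rest_hall n j.
rewrite mulrC -scalerA -e scaler_nat ev_iter_ad -mulrnDl.
have -> : (n - j = (n - j.+1).+1)%N by rewrite -subSn // subSS.
rewrite iterSr [lie (iota x1) _]lieC iter_lieN /low /ad1 ev_iter_ad /=.
by rewrite [lie (- _) _]lieC linearN /= opprK lieC addNr mul0rn.
Qed.

(** With equal orientations the factors D^j z agree, and their length determines j; opposite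
    orientations would equate some D^i (x0, x1) with some D^k z. *)
Let rest_inj n : {in [pred j | j < n]%N &, injective (rest n)}.
Proof.
move=> i j; rewrite !inE => lin ljn; rewrite /rest /hall_pair.
have inj_high k l : ad1 k z = ad1 l z -> k = l.
  by move=> /(congr1 (@leaves X)); rewrite !leaves_iter_ad; lia.
case: ifP => _; case: ifP => _ [].
- by move=> _ /inj_high.
- by move=> /low_neq_high.
- by move=> /esym/low_neq_high.
- by move=> /inj_high.
Qed.

(** The left factor of the first is x1, whereas both factors of [rest n j] are above x1. *)
Let rest_neq n j : (j < n)%N -> ad1 n (Node (Leaf x0) z) <> rest n j.
Proof.
case: n => // n jn; have leaf_neq t : lt (Leaf x1) t -> Leaf x1 <> t.
  by move=> h e; apply: (hall_lt_irr hB B1); rewrite -e in h.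
have [_ ltl _] := low_hall (n.+1 - j.+1); have [_ lth _] := high_hall j.
rewrite /rest /hall_pair.
by case: ifP => _ [] e _; [move: ltl|move: lth] => /leaf_neq; apply.
Qed.

(** Used with z = X2, where X0 does not occur, and with z = (X0, (X0, X1)), where it occurs
    twice. *)
Lemma hall_norm_ad_chain n :
  B (iter n (ad (Leaf x1)) z) /\
  hall_norm iota B (lie (ev iota (Leaf x0)) (ev iota (iter n (ad (Leaf x1)) z)))
    = 2 ^+ n.
Proof.
split; first by case: (high_hall n).
rewrite (hall_norm_expansion hB hL _ (bracket_expansion n)).
- rewrite big_cons normr1 big_map big_mkord.
  under eq_bigr => j _ do rewrite normrM normr_sign mul1r normr_nat.
  rewrite -natr_sum -[1]/(1%:R) -natrD -natrX; congr (_%:R).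
  (* The leading coefficient 1 supplies the missing binomial j = n in the expansion of (1 + 1)^n. *)
  rewrite -[2%N]/(1 + 1)%N expnDn big_ord_recr /= binn !exp1n !muln1 addnC.
  by congr (_ + _)%N; apply: eq_bigr => j _; rewrite !exp1n !muln1.
- move=> p; rewrite inE => /orP[/eqP->|/mapP[j _ ->]]; last first.
    by case: (rest_hall n j).
  by case: (@ad1_hall n (Node (Leaf x0) z)) => //; [apply: lt1_node|right; left].
rewrite /= -map_comp; apply/andP; split.
  by apply/mapP => -[j]; rewrite mem_index_iota => /andP[_ jn] /(rest_neq jn).
rewrite map_inj_in_uniq ?iota_uniq // => i j.
by rewrite !mem_index_iota /= => li lj; apply: rest_inj.
Qed.

End AdChains.

Lemma letters_of_card2 (X : Type) : [set: X] #= `I_2 ->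
  exists x y : X, x <> y /\ forall z, z = x \/ z = y.
Proof.
move=> /card_set_bijP[f [fI f_inj f_surj]].
have [x _ fx] := f_surj 0%N isT; have [y _ fy] := f_surj 1%N isT.
exists x, y; split=> [e|z]; first by move: fy; rewrite -e /= fx.
have f_eq u v : f u = f v -> u = v by apply: f_inj; rewrite inE.
have : (f z < 2)%N by apply: fI.
case E: (f z) => [|[|]] // _; [left|right]; apply: f_eq.
  by rewrite E fx.
by rewrite E fy.
Qed.

Theorem proposition6p11
  (R : realType) (K : numFieldType) (hK : real_or_complex R K)
  (X : Type) (hX : `I_2 #<= [set: X])
  (L : lieAlgType K) (iota : X -> L) (hL : free_lie iota)
  (B : set (br X)) (lt : br X -> br X -> Prop)
  (hB : hall_set B lt) (hlen : length_compatible B lt) :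
  [/\ (* 1 *)
      `I_3 #<= [set: X] ->
      forall a b : br X, B a -> B b -> lt a b ->
        hall_norm iota B (lie (ev iota a) (ev iota b)) <= 2 ^+ (leaves b - 1),
      (* 2 *)
      forall X0 X1 X2 : X,
        lt (Leaf X0) (Leaf X1) -> lt (Leaf X1) (Leaf X2) ->
        forall n : nat,
          B (iter n (ad (Leaf X1)) (Leaf X2)) /\
          hall_norm iota B
            (lie (ev iota (Leaf X0))
                 (ev iota (iter n (ad (Leaf X1)) (Leaf X2)))) = 2 ^+ n,
      (* 3 *)
      [set: X] #= `I_2 ->
      forall a b : br X, B a -> B b -> lt a b -> (3 <= leaves b)%N ->
        hall_norm iota B (lie (ev iota a) (ev iota b)) <= 2 ^+ (leaves b - 3)
    & (* 4 *)
      forall X0 X1 : X,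
        [set: X] = [set X0; X1] -> lt (Leaf X0) (Leaf X1) ->
        forall n : nat,
          B (iter n (ad (Leaf X1)) (iter 2 (ad (Leaf X0)) (Leaf X1))) /\
          hall_norm iota B
            (lie (ev iota (Leaf X0))
                 (ev iota (iter n (ad (Leaf X1))
                             (iter 2 (ad (Leaf X0)) (Leaf X1))))) = 2 ^+ n].
Proof.
have bound a b N m : B a -> B b -> lt a b ->
    bracket_decomposition B lt iota a b N -> (N.+1 <= 2 ^ m)%N ->
    hall_norm iota B (lie (ev iota a) (ev iota b)) <= 2 ^+ m.
  move=> Ba Bb ab dN Nm.
  apply: le_trans (bracket_decomposition_norm hB hL Ba Bb ab dN) _.
  by rewrite -natrX ler_nat.
split.
- move=> _ a b Ba Bb ab.
  have [N dN Nb] := bracket_decomposition_exists hB hlen iota Ba Bb ab.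
  exact: bound dN Nb.
- move=> x0 x1 x2 x01 x12 n; have Bl x : B (Leaf x) := hall_leaf hB x.
  apply: (hall_norm_ad_chain hB hlen hL) => //; first by left; exists x2.
  (* x2 = x0 would give the cycle x0 < x1 < x0. *)
  rewrite /=; case: asboolP => //= e; move: x12; rewrite e => x10.
  case: (hall_lt_irr hB (Bl x0)).
  exact: (hall_lt_trans hB (Bl x0) (Bl x1) (Bl x0) x01 x10).
- move=> /letters_of_card2[x [y [xy two]]] a b Ba Bb ab _.
  have [N dN Nb] : exists2 N, bracket_decomposition B lt iota a b N &
      (N.+1 <= 2 ^ (leaves b - 3))%N.
    have [xy'|[exy]|yx] := hall_lt_total hB (hall_leaf hB x) (hall_leaf hB y).
    + exact: (bracket_decomposition_two_letters hB hlen iota xy' two).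
    + by case: xy.
    + apply: (bracket_decomposition_two_letters hB hlen iota yx) => // z.
      by case: (two z); [right|left].
  exact: bound dN Nb.
- move=> x0 x1 _ x01 n; have B0 := hall_leaf hB x0; have B1 := hall_leaf hB x1.
  have B01 : B (Node (Leaf x0) (Leaf x1)).
    by apply: (hall_node_in hB) => //; left; exists x1.
  have B001 : B (Node (Leaf x0) (Node (Leaf x0) (Leaf x1))).
    apply: (hall_node_in hB) => //; last by right; right.
    exact: (hall_lt_node hB).
  apply: (hall_norm_ad_chain hB hlen hL) => //.
  + exact: (lt_leaves hB hlen).
  + by right; right.
  by rewrite /=; case: asboolP.
Qed.
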